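(* Left cancellative $k$-translatable semigroups of the same order are isomorphic. That is, if $Q$ and $G$ are left cancellative semigroups of the same order $n$, each $k$-translatable (for the same $k$) with respect to some ordering of its elements, then $Q$ and $G$ are isomorphic.
   Context: A groupoid is a set with a binary operation $\cdot$; a semigroup is an associative groupoid. It is left cancellative if $x\cdot y=x\cdot z$ implies $y=z$. For an integer $x$, $[x]_n$ denotes the residue of $x$ modulo $n$, represented in $\{1,\ldots,n\}$, with $0$ identified with $n$. For $1\le k<n$, a groupoid $Q$ of order $n$ is $k$-translatable with respect to an ordering $q_1,\ldots,q_n$ of its elements if in its multiplication table (rows and columns listed in this order) each row is obtained from the preceding one by cyclically shifting it $k$ places to the right, i.e. $q_i\cdot q_j=q_{i-1}\cdot q_{[j-k]_n}$ for all $j$ and all $2\le i\le n$. *)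

(* Defs.v *)
From mathcomp Require Import all_boot.

Set Implicit Arguments.
Unset Strict Implicit.
Unset Printing Implicit Defensive.

Local Open Scope group_scope.

Definition left_cancellative (Q : magmaType) : Prop :=
  forall x y z : Q, x * y = x * z -> y = z.

(* The ordering is indexed from 0: [q i] is the element written q_(i+1) in the
   1-based convention.  The column j' with j' + k = j (mod n) is the unique
   index in 'I_n representing j - k, and this does not depend on whether both
   j and j' are numbered from 0 or from 1. *)
Definition rows_shifted (n k : nat) (Q : magmaType) (q : 'I_n -> Q) : Prop :=
  forall i i' j j' : 'I_n,
    i = i'.+1 :> nat -> (j' + k = j %[mod n])%N -> q i * q j = q i' * q j'.

(* A bijection from 'I_n expresses both that Q has order n and that its
   elements are listed as a sequence without repetition. *)
Definition k_translatable (n k : nat) (Q : magmaType) : Prop :=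
  [/\ (1 <= k)%N, (k < n)%N
    & exists q : 'I_n -> Q, bijective q /\ rows_shifted k q].

Definition isomorphic (Q G : magmaType) : Prop :=
  exists f : {multiplicative Q -> G}, bijective f.

(* Main.v *)
Require Import Defs.
From HB Require Import structures.
From mathcomp Require Import all_boot all_algebra ring.

(** The idea is to number the rows and columns by the ring Z/n.  Moving from row
    i to row 0 shifts the entries by k i, so the whole table is determined by
    its row 0: q_i q_j = q_0 q_(j - k i) ([mul_row0]).  Let c be the index of
    q_0 q_0.  Associativity gives q_0 (q_0 q_l) = q_c q_l = q_0 q_(l - k c), and
    cancelling q_0 on the left gives q_0 q_l = q_(l - k c); the case l = 0 says
    that c = - k c.  Hence q_i q_j = q_(j - k i + c) with k c = - c
    ([affine_table]): up to isomorphism the semigroup is Z/n with the operation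
    (i, j) |-> j - k i + c.

    Two such operations, with constants c and c', are exchanged by a translation
    x |-> x + d as soon as c = c' - k d, and since k c = - c and k c' = - c', the
    choice d = c - c' works. *)

Import GRing.Theory.
Local Open Scope ring_scope.

(** Iterating the shift from row i down to row 0 moves column j to column
    j - k i.  The order is written m.+2 so that the indices form the ring Z/n,
    where this is meaningful without taking residues. *)
Lemma mul_row0 (m k : nat) (Q : magmaType) (q : 'I_m.+2 -> Q) (i j : 'I_m.+2) :
  rows_shifted k q -> (q i * q j)%g = (q 0 * q (j - k%:R * i))%g.
Proof.
move=> shq; case: i => i; elim: i j => [|i IHi] j lt_i.
  have -> : Ordinal lt_i = 0 by apply: val_inj.
  by rewrite mulr0 subr0.
have lt_i' : (i < m.+2)%N := ltnW lt_i.
rewrite (shq _ (Ordinal lt_i') _ (j - k%:R)) //=.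
  rewrite IHi.
  have -> : Ordinal lt_i = Ordinal lt_i' + 1.
    by apply: val_inj; rewrite /= !modn_small // addn1.
  by congr (_ * q _)%g; ring.
(* It remains to see that the two columns are congruent modulo n; this is read
   off from an equality in Z/n, whose elements are their own residues. *)
have val_nat (x : 'I_m.+2) : (x : nat)%:R = x := natr_Zp x.
have /(congr1 val) : ((j - k%:R)%R + k)%:R = (j : nat)%:R :> 'Z_m.+2.
  by rewrite natrD !val_nat subrK.
by rewrite /= !val_Zp_nat.
Qed.

(** Since every row is a shift of row 0, it suffices to know that row 0 is itself
    a shift of the ordering.  Row c is such that q_c = q_0 q_0, so associativity
    relates it to row 0 applied twice, and cancelling q_0 leaves row 0 alone. *)
Lemma affine_table (m k : nat) (Q : semigroupType) :
  left_cancellative Q -> k_translatable m.+2 k Q ->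
  exists q : 'I_m.+2 -> Q, exists2 c : 'I_m.+2, bijective q &
    k%:R * c = - c /\ forall i j, (q i * q j)%g = q (j - k%:R * i + c).
Proof.
move=> cancQ [_ _ [q [bij_q shq]]].
have [p qK pK] := bij_q; pose c := p (q 0 * q 0)%g.
have q00 : (q 0 * q 0)%g = q c by rewrite pK.
have row0 l : (q 0 * q l)%g = q (l - k%:R * c).
  by apply: (cancQ (q 0)); rewrite mulgA q00 (mul_row0 _ _ _ _ c _ shq).
have kc : k%:R * c = - c.
  apply: oppr_inj; rewrite opprK; apply: (bij_inj bij_q).
  by rewrite -q00 row0 sub0r.
exists q, c => //; split=> // i j.
by rewrite (mul_row0 _ _ _ _ _ _ shq) row0 kc opprK.
Qed.

Theorem corollary5p7 (n k : nat) (Q G : semigroupType)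
  (hQc : left_cancellative Q) (hGc : left_cancellative G)
  (hQt : k_translatable n k Q) (hGt : k_translatable n k G) :
  isomorphic Q G.
Proof.
(* The bounds 1 <= k < n force n >= 2, so that 'I_n is the ring Z/n. *)
case: n hQt hGt => [|[|m]] hQt hGt; first by case: hQt.
  by case: hQt; case: k {hGt}.
have [q [c bij_q [kc mulq]]] := affine_table _ _ _ hQc hQt.
have [g [c' bij_g [kc' mulg]]] := affine_table _ _ _ hGc hGt.
have [p qK pK] := bij_q.
(* In the index coordinates, f is the translation by d = c - c'. *)
pose f x := g (p x + (c - c')).
have fM : {morph f : x y / (x * y)%g >-> (x * y)%g}.
  move=> x y; rewrite /f mulg -{1}(pK x) -{1}(pK y) mulq qK; congr g.
  by rewrite mulrDr mulrBr kc kc'; ring.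
pose fMM := isMultiplicative.Build Q G f fM.
pose F : {multiplicative Q -> G} := HB.pack f fMM.
have bij_add : bijective (fun x : 'I_m.+2 => x + (c - c')).
  by exists (fun x => x - (c - c')) => x; rewrite ?addrK ?subrK.
have bij_p : bijective p by exists q.
by exists F; exact: (bij_comp bij_g (bij_comp bij_add bij_p)).
Qed.
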